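(* There exists a constant $c>0$ such that for all $0<\alpha<1/2$ and all sufficiently large primes $N>N_0(\alpha)$, there exists $f:\mathbb{Z}/N\mathbb{Z}\to[0,1]$ with $\mathbb{E}f\ge\alpha$ such that for every nonzero $d\in\mathbb{Z}/N\mathbb{Z}$, \[\mathbb{E}_tf(t)f(t+d)f(t+2d)f(t+5d)<(1-c)\alpha^4.\]
   Context: Expectations are over the uniform distribution on $\mathbb{Z}/N\mathbb{Z}$. *)

(* Defs.v *)
From mathcomp Require Import all_boot all_order all_algebra.
From mathcomp Require Import reals.

Set Implicit Arguments.
Unset Strict Implicit.
Unset Printing Implicit Defensive.

Import Order.TTheory GRing.Theory Num.Theory.
Local Open Scope ring_scope.

Definition expect (R : realType) (T : finType) (g : T -> R) : R :=
  (\sum_(t : T) g t) / #|T|%:R.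

(* Main.v *)
Require Import Defs.
From mathcomp Require Import all_boot all_order all_algebra.
From mathcomp Require Import reals complex ring lra.

Set Implicit Arguments.
Unset Strict Implicit.
Unset Printing Implicit Defensive.

Import Order.TTheory GRing.Theory Num.Theory.
Local Open Scope ring_scope.

(** Take [f] proportional to
      [g t = 1 + (cos u + cos 6u + cos 10u - cos 15u) / 8],
    [u = 2 pi t^2 / N].
    Expanding the product over the pattern [t, t + d, t + 2d, t + 5d] gives
    phases [k0 t^2 + k1 (t+d)^2 + k2 (t+2d)^2 + k5 (t+5d)^2] with each [ki] in
    [{0, ±1, ±6, ±10, ±15}].  For [d != 0] such a phase averages to
    [O(N^(-1/2))] (a Gauss sum) unless it has no [t^2] and no [t] term, which
    happens only for [k = 0] and [k = ±(-6, 15, -10, 1)].  The latter are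
    proportional to the third divided difference at [0, 1, 2, 5], so their
    phase vanishes identically, and they contribute [- 2 / 16^4] because of
    the minus sign in front of [cos 15u]. *)

(** * Roots of unity of prime order and units modulo a prime *)

(** Take a root [z] of 1 + X + ... + X^(N-1). Its order divides the prime [N], and order 1 would
    give [N = 0] in characteristic 0. *)
Lemma prime_primitive_root_exists (C : numClosedFieldType) (N : nat) :
  prime N -> exists z : C, N.-primitive_root z.
Proof.
move=> pN; have N1 : (0 < N.-1)%N by rewrite -ltnS prednK ?prime_gt1 ?prime_gt0.
have [z zE] := solve_monicpoly (fun=> -1 : C) N1.
have sz0 : \sum_(i < N) z ^+ i = 0.
  rewrite -(prednK (prime_gt0 pN)) big_ord_recr /= zE.
  by rewrite -mulr_sumr mulN1r subrr.
have zN : z ^+ N = 1 by apply/eqP; rewrite -subr_eq0 subrX1 sz0 mulr0.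
have [m mz mN] := prim_order_exists (prime_gt0 pN) zN.
have [_ /(_ m mN) /pred2P[] mE] := primeP pN; last by exists z; rewrite -mE.
have z1 : z = 1 by have := prim_expr_order mz; rewrite mE expr1.
move/eqP: sz0; rewrite (eq_bigr (fun=> 1)) => [|i _]; last by rewrite z1 expr1n.
by rewrite sumr_const card_ord pnatr_eq0 gtn_eqF // prime_gt0.
Qed.

Lemma unitr_Zp_prime (N : nat) (x : 'Z_N) :
  prime N -> x != 0 -> x \is a GRing.unit.
Proof.
move=> pN x0; rewrite -(natr_Zp x) unitZpE ?prime_gt1 // prime_coprime //.
rewrite gtnNdvd ?lt0n //; apply: leq_trans (ltn_ord x) _.
by rewrite Zp_cast ?prime_gt1.
Qed.

Lemma unitr_intZp_prime (N : nat) (k : int) :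
  prime N -> k != 0 -> (absz k < N)%N -> (k%:~R : 'Z_N) \is a GRing.unit.
Proof.
move=> pN; have natU n : (0 < n < N)%N -> (n%:R : 'Z_N) \is a GRing.unit.
  by case/andP=> n0 nN; rewrite unitZpE ?prime_gt1 // prime_coprime // gtnNdvd.
case: k => n k0 kN.
  by rewrite -pmulrn natU // kN andbT lt0n; exact: k0.
by rewrite NegzE rmorphN unitrN natU.
Qed.

(** * Additive characters and Gauss sums *)

Section Character.
Variables (C : numClosedFieldType) (N : nat) (z : C).
Hypotheses (pN : prime N) (zP : N.-primitive_root z).
Implicit Types x y t d K L : 'Z_N.

Definition Zp_char x : C := z ^+ (x : nat).
Local Notation chi := Zp_char.

Lemma card_Zp_prime : #|'Z_N| = N.
Proof. by rewrite card_ord Zp_cast ?prime_gt1. Qed.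

Lemma Zp_char0 : chi 0 = 1.
Proof. by []. Qed.

Lemma Zp_charD x y : chi (x + y) = chi x * chi y.
Proof.
rewrite /chi -exprD -[in RHS](prim_expr_mod zP); congr (_ ^+ _) => /=.
by congr (_ %% _)%N; rewrite Zp_cast ?prime_gt1.
Qed.

Lemma Zp_char_eq1 x : (chi x == 1) = (x == 0).
Proof.
rewrite /chi -(expr0 z) (eq_prim_root_expr zP) mod0n modn_small //.
by apply: leq_trans (ltn_ord x) _; rewrite Zp_cast ?prime_gt1.
Qed.

Lemma Zp_char_neq0 x : chi x != 0.
Proof. by rewrite expf_neq0 // (prim_root_eq0 zP) gtn_eqF ?prime_gt0. Qed.

Lemma norm_Zp_char x : `|chi x| = 1.
Proof.
have z1 : `|z| = 1.
  apply/eqP; rewrite -(@pexpr_eq1 _ _ N) ?prime_gt0 // -normrX.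
  by rewrite (prim_expr_order zP) normr1.
by rewrite normrX z1 expr1n.
Qed.

Lemma conj_Zp_char x : (chi x)^* = chi (- x).
Proof.
apply: (mulfI (Zp_char_neq0 x)).
by rewrite -Zp_charD subrr Zp_char0 -normCK norm_Zp_char expr1n.
Qed.

(** Shifting [t] by 1 multiplies the sum by [chi u], which differs from 1 when [u != 0]. *)
Lemma sum_Zp_char (u : 'Z_N) : \sum_t chi (u * t) = if u == 0 then N%:R else 0.
Proof.
case: eqVneq => [->|u0].
  under eq_bigr do rewrite mul0r Zp_char0.
  by rewrite sumr_const card_Zp_prime.
have : (chi u - 1) * \sum_t chi (u * t) = 0.
  rewrite mulrBl mul1r mulr_sumr; apply/eqP; rewrite subr_eq0; apply/eqP.
  rewrite [RHS](reindex_inj (addrI 1)); apply: eq_bigr => t _.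
  by rewrite mulrDr mulr1 Zp_charD.
by move/eqP; rewrite mulf_eq0 subr_eq0 Zp_char_eq1 (negPf u0) => /eqP.
Qed.

(* Weyl differencing: substituting [s := t + h] in the double sum for
   [|S|^2] leaves, for each [h], a linear sum with slope [2 K h]. *)
Lemma norm_gauss_sum K L : K *+ 2 \is a GRing.unit ->
  `|\sum_t chi (K * t ^+ 2 + L * t)| ^+ 2 = N%:R.
Proof.
move=> K2; rewrite normCK rmorph_sum mulr_suml /=.
under eq_bigr => t _ do rewrite mulr_sumr (reindex_inj (addrI t)) /=.
rewrite exchange_big /= (bigD1 0) //= [X in _ + X]big1 => [|h h0].
  under eq_bigr do rewrite addr0 conj_Zp_char -Zp_charD subrr Zp_char0.
  by rewrite sumr_const card_Zp_prime addr0.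
rewrite (eq_bigr (fun t => chi (- (K * h ^+ 2 + L * h)) *
                           chi (- (K *+ 2 * h) * t))) => [|t _].
  rewrite -mulr_sumr sum_Zp_char oppr_eq0.
  by rewrite (mulrI_eq0 _ (mulrI K2)) (negPf h0) mulr0.
rewrite conj_Zp_char -!Zp_charD; congr chi; ring.
Qed.

(** [N_large] says N^(-1/2) <= [eps], squared so as to avoid roots in [C]. *)
Variable eps : C.
Hypotheses (eps_ge0 : 0 <= eps) (N_large : 1 <= N%:R * eps ^+ 2).

Lemma mean_gauss_sum K L : K *+ 2 \is a GRing.unit ->
  `|(\sum_t chi (K * t ^+ 2 + L * t)) / N%:R| <= eps.
Proof.
move=> K2; have N0 : 0 < N%:R :> C by rewrite ltr0n prime_gt0.
rewrite normrM normfV normr_nat ler_pdivrMr //.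
rewrite -ler_sqr ?nnegrE ?mulr_ge0 ?(ltW N0) // norm_gauss_sum //.
rewrite exprMn [X in _ <= _ * X]expr2 mulrA [_ * N%:R]mulrC ler_peMr ?(ltW N0) //.
by rewrite mulrC.
Qed.

(** For [k != 0] this is a Gauss sum; for [k = 0] it is a linear sum of nonzero slope, which
    vanishes. The size bounds make nonzero integer coefficients units modulo [N]. *)
Lemma mean_quadratic_phase (k l : int) (d m : 'Z_N) :
  (absz k < N)%N -> (absz l < N)%N -> (2 < N)%N -> d != 0 ->
  (k != 0) || (l != 0) ->
  `|(\sum_t chi (k%:~R * t ^+ 2 + l%:~R * d *+ 2 * t + m)) / N%:R| <= eps.
Proof.
move=> kN lN N2 d0 kl0; rewrite (eq_bigr (fun t =>
  chi (k%:~R * t ^+ 2 + l%:~R * d *+ 2 * t) * chi m)) => [|t _]; last first.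
  exact: Zp_charD.
rewrite -mulr_suml mulrAC normrM norm_Zp_char mulr1.
have U2 : (2%:R : 'Z_N) \is a GRing.unit by apply: (@unitr_intZp_prime N 2).
have [k0|k0] := eqVneq k 0; last first.
  by apply: mean_gauss_sum; rewrite -mulr_natr unitrM U2 unitr_intZp_prime.
move: kl0; rewrite k0 eqxx /= => l0.
rewrite (eq_bigr (fun t => chi (l%:~R * d *+ 2 * t))) => [|t _]; last first.
  by rewrite mul0r add0r.
have lU := unitr_intZp_prime pN l0 lN.
have ld0 : (l%:~R * d *+ 2 == 0) = false.
  by rewrite -mulr_natl (mulrI_eq0 _ (mulrI U2)) (mulrI_eq0 _ (mulrI lU)) (negPf d0).
by rewrite sum_Zp_char ld0 mul0r normr0.
Qed.

(** Resonant terms are constant in [t] and survive exactly; every other term costs at most [eps]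
    times its weight. *)
Lemma mean_phase_sum (I : eqType) (s : seq I) (w : I -> C) (k l : I -> int)
    (m : I -> 'Z_N) (d : 'Z_N) :
  (2 < N)%N -> d != 0 ->
  {in s, forall i, (absz (k i) < N)%N && (absz (l i) < N)%N} ->
  `|(\sum_t \sum_(i <- s) w i *
       chi ((k i)%:~R * t ^+ 2 + (l i)%:~R * d *+ 2 * t + m i)) / N%:R
    - \sum_(i <- s | (k i == 0) && (l i == 0)) w i * chi (m i)|
  <= eps * \sum_(i <- s) `|w i|.
Proof.
move=> N2 d0 klN; have N0 : N%:R != 0 :> C by rewrite pnatr_eq0 gtn_eqF ?prime_gt0.
rewrite exchange_big mulr_suml [X in _ - X]big_mkcond -sumrB mulr_sumr /=.
apply: le_trans (ler_norm_sum _ _ _) _; rewrite !big_seq.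
apply: ler_sum => i /klN /andP[kN lN]; rewrite -mulr_sumr -mulrA.
case: ifPn => [/andP[/eqP -> /eqP ->]|]; last first.
  rewrite negb_and subr0 normrM mulrC => kl0.
  by rewrite ler_wpM2r // mean_quadratic_phase.
rewrite (eq_bigr (fun=> chi (m i))) => [|t _]; last first.
  by rewrite !mul0r mul0rn mul0r !add0r.
rewrite sumr_const card_Zp_prime -[chi _ *+ N]mulr_natr mulfK // subrr normr0.
by rewrite mulr_ge0.
Qed.

(** * The quadratic trigonometric polynomial and its averages *)

Definition freqs : seq int := [:: 0; 1; -1; 6; -6; 10; -10; 15; -15].

(** Each cosine with coefficient 1/8 splits into 1/16 at each of the frequencies [k] and [- k]. *)
Definition weight (k : int) : C :=
  if k == 0 then 1 else if absz k == 15 then - (16%:R)^-1 else (16%:R)^-1.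

Definition quad_poly t : C := \sum_(k <- freqs) weight k * chi (k%:~R * t ^+ 2).

Lemma sum_norm_weight : \sum_(k <- freqs) `|weight k| = 3 / 2.
Proof.
rewrite !big_cons big_nil /weight /= normr1 !normrN normfV normr_nat.
by field; rewrite ?pnatr_eq0.
Qed.

Lemma weight_real k : weight k \is Num.real.
Proof. by rewrite /weight; do 2?case: ifP => _; rewrite ?rpredN ?rpredV ?realn. Qed.

Lemma quad_poly_real t : quad_poly t \is Num.real.
Proof.
(* Conjugation negates frequencies; [freqs] is symmetric and [weight] is even and real. *)
rewrite CrealE /quad_poly rmorph_sum /=.
rewrite [X in _ == X](perm_big [seq - k | k <- freqs]) // big_map.
apply/eqP; apply: eq_bigr => k _.
rewrite rmorphM /= conj_Zp_char rmorphN mulNr; congr (_ * _).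
by rewrite /weight oppr_eq0 abszN; exact: CrealP (weight_real k).
Qed.

(** The eight nonconstant terms have total weight 8/16. *)
Lemma quad_poly_bounds t : 1 / 2 <= quad_poly t <= 3 / 2.
Proof.
suff : `|quad_poly t - 1| <= 1 / 2.
  rewrite real_ler_norml ?rpredB ?quad_poly_real ?real1 // lerBrDr lerBlDr.
  have -> : - (1 / 2) + 1 = 1 / 2 :> C by field.
  by have -> : 1 / 2 + 1 = 3 / 2 :> C by field.
have -> : 1 / 2 = \sum_(k <- behead freqs) `|weight k| :> C.
  by move: sum_norm_weight; rewrite big_cons /= normr1 => /(canRL (addKr _)) ->; field.
rewrite /quad_poly big_cons /= mul0r Zp_char0 mulr1 addrC addKr.
apply: le_trans (ler_norm_sum _ _ _) _; apply: ler_sum => k _.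
by rewrite normrM norm_Zp_char mulr1.
Qed.

Lemma mean_quad_poly : (15 < N)%N ->
  `|(\sum_t quad_poly t) / N%:R - 1| <= eps * (3 / 2).
Proof.
move=> N15; have := @mean_phase_sum _ freqs weight id (fun=> 0) (fun=> 0) 1.
rewrite sum_norm_weight => /(_ (leq_trans _ N15) (oner_neq0 _)).
have smallN : {in freqs, forall k, (absz k < N)%N && (0 < N)%N}.
  have /allP ? : all (fun k => absz k < 16)%N freqs by [].
  by move=> k /= kf; rewrite prime_gt0 // andbT (leq_trans _ N15) //; auto.
move=> /(_ isT smallN); congr (`|_ / _ - _| <= _).
  apply: eq_bigr => t _; apply: eq_bigr => k _.
  by rewrite mul0r mul0rn mul0r !addr0.
by rewrite unlock /= addr0 mulr1.
Qed.

(* [((k0, k1), (k2, k5))] stands for the phase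
   [k0 t^2 + k1 (t+d)^2 + k2 (t+2d)^2 + k5 (t+5d)^2], whose coefficients of
   [t^2] and [2 d t] are [quad_t2] and [quad_td]. *)
Definition quads : seq ((int * int) * (int * int)) :=
  [seq (p, q) | p <- [seq (k, l) | k <- freqs, l <- freqs],
                q <- [seq (k, l) | k <- freqs, l <- freqs]].
Definition quad_t2 (q : (int * int) * (int * int)) : int :=
  q.1.1 + q.1.2 + (q.2.1 + q.2.2).
Definition quad_td (q : (int * int) * (int * int)) : int :=
  q.1.2 + (q.2.1 * 2 + q.2.2 * 5).
Definition quad_d2 (q : (int * int) * (int * int)) : int :=
  q.1.2 + (q.2.1 * 4 + q.2.2 * 25).
Definition quad_weight (q : (int * int) * (int * int)) : C :=
  weight q.1.1 * weight q.1.2 * (weight q.2.1 * weight q.2.2).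

(** The largest value is 15 * (1 + 2 + 5) = 120, reached by [quad_td]. *)
Lemma quads_small :
  {in quads, forall q, (absz (quad_t2 q) < 121)%N && (absz (quad_td q) < 121)%N}.
Proof. by apply/allP; vm_compute. Qed.

Lemma quads_resonant :
  [seq q <- quads | (quad_t2 q == 0) && (quad_td q == 0)] =
  [:: ((0, 0), (0, 0)); ((6, -15), (10, -1)); ((-6, 15), (-10, 1))].
Proof. by vm_compute. Qed.

Lemma sum_quads (F G H K : int -> C) :
  \sum_(q <- quads) F q.1.1 * G q.1.2 * (H q.2.1 * K q.2.2) =
  (\sum_(k <- freqs) F k) * (\sum_(k <- freqs) G k) *
  ((\sum_(k <- freqs) H k) * (\sum_(k <- freqs) K k)).
Proof.
rewrite /quads big_allpairs [in RHS]big_distrlr [X in _ = _ * X]big_distrlr /=.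
rewrite -(big_allpairs (F := fun p => F p.1 * G p.2)).
by rewrite -(big_allpairs (F := fun p => H p.1 * K p.2)) big_distrlr.
Qed.

Lemma mean_quad_poly_pattern d : (120 < N)%N -> d != 0 ->
  `|(\sum_t quad_poly t * quad_poly (t + d) * quad_poly (t + d *+ 2)
            * quad_poly (t + d *+ 5)) / N%:R - (1 - 2 / 16 ^+ 4)|
  <= eps * (3 / 2) ^+ 4.
Proof.
move=> N120 d0.
have := @mean_phase_sum _ quads quad_weight quad_t2 quad_td
  (fun q => (quad_d2 q)%:~R * d ^+ 2) d (leq_trans _ N120) d0.
have -> : \sum_(q <- quads) `|quad_weight q| = (3 / 2) ^+ 4.
  under eq_bigr do rewrite !normrM.
  pose w k := `|weight k|; rewrite (sum_quads w w w w) /w sum_norm_weight.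
  by rewrite -!expr2 -exprM.
have smallN : {in quads, forall q, (absz (quad_t2 q) < N)%N && (absz (quad_td q) < N)%N}.
  move=> q /quads_small /andP[k120 l120].
  by rewrite !(leq_trans _ N120).
move=> /(_ isT smallN); congr (`|_ / _ - _| <= _).
  apply: eq_bigr => t _.
  rewrite -mulrA /quad_poly -sum_quads; apply: eq_bigr => -[[a b] [c e]] _ /=.
  have -> : (quad_t2 (a, b, (c, e)))%:~R * t ^+ 2
      + (quad_td (a, b, (c, e)))%:~R * d *+ 2 * t
      + (quad_d2 (a, b, (c, e)))%:~R * d ^+ 2
    = a%:~R * t ^+ 2 + b%:~R * (t + d) ^+ 2
      + (c%:~R * (t + d *+ 2) ^+ 2 + e%:~R * (t + d *+ 5) ^+ 2).
    by rewrite /quad_t2 /quad_td /quad_d2 /=; ring.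
  by rewrite !Zp_charD /quad_weight /=; ring.
(* For both nontrivial resonances [quad_d2] also vanishes (-15 + 40 - 25 = 0), so each contributes
   exactly -1/16^4. *)
rewrite -big_filter quads_resonant !big_cons big_nil /quad_weight /weight /quad_d2 /=.
rewrite !mul0r Zp_char0.
by field; rewrite ?pnatr_eq0.
Qed.

End Character.

(** * Return to the reals and choice of constants *)

Lemma norm_complexR_le (R : rcfType) (x e : R) :
  `|x%:C%C| <= e%:C%C -> `|x| <= e.
Proof. by rewrite -lecR; apply: le_trans (normc_ge_Re x%:C%C). Qed.

Theorem proposition6p1 (R : realType) :
  exists c : R, 0 < c /\
    forall alpha : R, 0 < alpha -> alpha < 1 / 2 ->
      exists N0 : nat, forall N : nat, prime N -> (N0 < N)%N ->
        exists f : 'Z_N -> R,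
          (forall t : 'Z_N, 0 <= f t <= 1) /\
          alpha <= expect f /\
          (forall d : 'Z_N, d != 0 ->
             expect (fun t : 'Z_N =>
               f t * f (t + d) * f (t + d *+ 2) * f (t + d *+ 5))
             < (1 - c) * alpha ^+ 4).
Proof.
(* [eta] is the gain from the two nontrivial resonances; half of it is given up to absorb the
   errors. *)
pose eta : R := 2 / 16 ^+ 4.
exists (eta / 2); split; first by rewrite /eta; lra.
move=> alpha alpha_gt0 alpha_lt.
pose eps : R := eta / 100.
have eps_gt0 : 0 < eps by rewrite /eps /eta; lra.
(* The bound 120 serves [quads_small]; the other gives [N * eps^2 >= 1]. *)
exists (maxn 120 (Num.bound (eps ^- 2))) => N pN; rewrite gtn_max => /andP[N120 NB].
have N_large : 1 <= N%:R * eps ^+ 2.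
  rewrite -ler_pdivrMr ?exprn_gt0 // mul1r ltW //.
  apply: lt_trans (_ : (Num.bound (eps ^- 2))%:R < _); last by rewrite ltr_nat.
  by rewrite archi_boundP // invr_ge0 exprn_ge0 // ltW.
have [z zP] := prime_primitive_root_exists R[i]%C pN.
pose g (t : 'Z_N) : R := complex.Re (quad_poly z t).
have gE t : (g t)%:C%C = quad_poly z t by rewrite RRe_real // quad_poly_real.
have g_bounds t : 1 / 2 <= g t <= 3 / 2.
  have := quad_poly_bounds pN zP t; rewrite -gE.
  by rewrite -!lecR !rmorphM !fmorphV !rmorph_nat.
have eps_ge0 : 0 <= eps%:C%C by rewrite (lecR 0) ltW.
have N_largeC : 1 <= N%:R * eps%:C%C ^+ 2.
  by rewrite -(rmorph_nat (real_complex R)) -rmorphXn -rmorphM (lecR 1).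
have expectE (h : 'Z_N -> R) :
    (expect h)%:C%C = (\sum_t (h t)%:C%C) / N%:R.
  by rewrite /expect (card_Zp_prime pN) rmorphM fmorphV rmorph_nat rmorph_sum.
have half3C : (3 / 2)%:C%C = 3 / 2 :> R[i]%C.
  by rewrite rmorphM fmorphV !rmorph_nat.
have etaC : eta%:C%C = 2 / 16 ^+ 4 :> R[i]%C.
  by rewrite /eta rmorphM fmorphV rmorphXn !rmorph_nat.
set m := expect g.
have m_near1 : `|m - 1| <= eps * (3 / 2).
  have N15 : (15 < N)%N by apply: leq_trans N120.
  have := mean_quad_poly pN zP eps_ge0 N_largeC N15.
  rewrite -(eq_bigr _ (fun t _ => gE t)) -expectE => mC.
  apply: norm_complexR_le.
  by rewrite rmorphB rmorph1 (rmorphM _ eps) /= half3C.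
have m_lo : 1 - eps * (3 / 2) <= m by move: m_near1; rewrite ler_norml; lra.
have m_gt : 99 / 100 < m by apply: lt_le_trans m_lo; rewrite /eps /eta; lra.
have m0 : m != 0 by rewrite gt_eqF //; lra.
have b_gt0 : 0 < alpha / m by rewrite divr_gt0 //; lra.
(* Since [g <= 3 / 2], this keeps the rescaled function at most 1; dividing by [m] makes its mean
   exactly [alpha]. *)
have b_le : alpha / m <= 2 / 3 by rewrite ler_pdivrMr; lra.
exists (fun t => alpha / m * g t); split.
  move=> t; have /andP[g_lo g_hi] := g_bounds t.
  by apply/andP; split; nra.
split; first by rewrite /expect -mulr_sumr -mulrA -/(expect g) -/m divfK.
move=> d d0; set P := expect (fun t => g t * g (t + d) * g (t + d *+ 2) * g (t + d *+ 5)).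
have P_hi : `|P - (1 - eta)| <= eps * (3 / 2) ^+ 4.
  have := mean_quad_poly_pattern pN zP eps_ge0 N_largeC N120 d0.
  rewrite (eq_bigr (fun t =>
    (g t * g (t + d) * g (t + d *+ 2) * g (t + d *+ 5))%:C%C)) => [|t _].
    rewrite -expectE => PC; apply: norm_complexR_le.
    by rewrite rmorphB (rmorphB _ 1) rmorph1 (rmorphM _ eps) rmorphXn /= half3C etaC.
  by rewrite !rmorphM /= !gE.
have -> : expect (fun t => alpha / m * g t * (alpha / m * g (t + d)) *
    (alpha / m * g (t + d *+ 2)) * (alpha / m * g (t + d *+ 5)))
    = alpha ^+ 4 * (P / m ^+ 4).
  rewrite /P /expect [_ / m ^+ 4]mulrAC mulrA; congr (_ / _).
  rewrite mulr_suml mulr_sumr; apply: eq_bigr => t _.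
  by field.
rewrite mulrC ltr_pM2r ?exprn_gt0 // ltr_pdivrMr ?exprn_gt0 //; last lra.
(* Bernoulli's inequality for (1 - 3 eps / 2)^4, by squaring twice. *)
have m4 : 1 - eps * 6 <= m ^+ 4.
  have m2 : 1 - eps * 3 <= m ^+ 2 by nra.
  by rewrite (exprM m 2 2); nra.
(* It remains that 1 - eta + (81/16) eps < (1 - eta/2) (1 - 6 eps), which holds for
   [eps = eta / 100]. *)
move: P_hi; rewrite ler_norml /eps /eta; move: m4; rewrite /eps /eta.
set M := m ^+ 4; lra.
Qed.
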